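(* For every string $w$ there is an integer $k$ with $0\le k\le 29$ such that $JHC^{k}(w)$ is a compound of common and transuranic elements (that is, every string decays in at most $29$ days to a compound of common and transuranic elements).
   Context: A string is a non-empty finite word whose letters are positive integers (each integer is a single letter, even if it has several decimal digits). Juxtaposition denotes concatenation, and $a^m$ denotes the letter $a$ repeated $m$ times. Conway's audioactive operator $JHC$: every string is uniquely written as $a_1^{m_1}a_2^{m_2}\cdots a_r^{m_r}$ with $m_i\ge 1$ and $a_i\ne a_{i+1}$ for all $i$; then $JHC(a_1^{m_1}a_2^{m_2}\cdots a_r^{m_r}) := m_1 a_1 m_2 a_2\cdots m_r a_r$ (a string of $2r$ letters). $JHC^k$ is the $k$-th iterate, $JHC^0$ being the identity. Passing from $w$ to $JHC(w)$ takes one day. Splitting: for strings $L,R$, the string $LR$ is said to split as $L.R$ if $JHC^n(LR)=JHC^n(L)\,JHC^n(R)$ for all $n\ge 0$. A string is an atom (or element) if it does not split as $L.R$ with both $L$ and $R$ non-empty. Every string $s$ can be written uniquely as $s=E_1E_2\cdots E_k$ ($k\ge1$) with each $E_i$ an atom and such that $JHC^n(s)=JHC^n(E_1)\cdots JHC^n(E_k)$ for all $n\ge0$; this is the splitting of $s$ into atoms, and $s$ is called a compound of the elements $E_1,\dots,E_k$. A string is a compound of elements from a given set if all the atoms in its splitting belong to that set. Common elements (also called stable elements): the 92 elements of Conway's periodic table. They are exactly the atoms that occur in the splitting of $JHC^n(1)$ for all sufficiently large $n$, where $1$ denotes the one-letter string; for example $22$ (hydrogen), $13$, $12$, $11132$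 and $13211$ are common elements. Transuranic elements: for every integer $n\ge 4$, the two strings $1311222113321132211221121332211n$ and $31221132221222112112322211n$, where the last letter is the integer $n$ and every other displayed digit is one letter. *)

(* Defs.v *)
From Stdlib Require Import Strings.Ascii Strings.String.
From mathcomp Require Import all_boot.

Set Implicit Arguments.
Unset Strict Implicit.
Unset Printing Implicit Defensive.

(* A string is a nonempty sequence of positive letters. *)
Definition is_string (w : seq nat) : bool := (w != [::]) && (0 \notin w).

(* The run decomposition: runs (a_1^m_1 ... a_r^m_r) is
   [:: (m_1, a_1); ...; (m_r, a_r)]. *)
Fixpoint runs (w : seq nat) : seq (nat * nat) :=
  if w is a :: w' then
    if runs w' is (m, b) :: rs then
      if a == b then (m.+1, b) :: rs else (1, a) :: (m, b) :: rs
    else [:: (1, a)]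
  else [::].

Definition JHC (w : seq nat) : seq nat :=
  flatten [seq [:: p.1; p.2] | p <- runs w].

Fact runs_spec (w : seq nat) :
  [/\ w = flatten [seq nseq p.1 p.2 | p <- runs w],
      all (fun p => 0 < p.1) (runs w) &
      sorted (fun p q => p.2 != q.2) (runs w)].
Proof.
elim: w => [|a w [IHw IHpos IHsort]] //=.
case: (runs w) IHw IHpos IHsort => [|[m b] rs] /= ->; first by [].
case: eqVneq => [->|ab] /=; split=> //=; last by rewrite ab.
  by case/andP: IHpos.
by case: rs {IHpos} IHsort.
Qed.

Definition splits (L R : seq nat) : Prop :=
  forall n, iter n JHC (L ++ R) = iter n JHC L ++ iter n JHC R.

Definition atom (E : seq nat) : Prop :=
  is_string E /\
  forall L R, L != [::] -> R != [::] -> E = L ++ R -> ~ splits L R.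

(* [Es] is the (unique) splitting of [s] into atoms; the equation at n = 0
   says that [s] is the concatenation of [Es]. *)
Definition is_splitting (s : seq nat) (Es : seq (seq nat)) : Prop :=
  [/\ Es != [::], {in Es, forall E, atom E} &
      forall n, iter n JHC s = flatten [seq iter n JHC E | E <- Es]].

Definition compound_of (P : seq nat -> Prop) (s : seq nat) : Prop :=
  exists2 Es, is_splitting s Es & {in Es, forall E, P E}.

(* The letters of a string written with one-digit letters. *)
Fixpoint letters (s : string) : seq nat :=
  if s is String c s' then (nat_of_ascii c - nat_of_ascii "0") :: letters s'
  else [::].

(* Conway's periodic table, from hydrogen (22) to uranium (3). *)
Definition periodic_table : seq (seq nat) := map letters
  [::
    "22"; "13112221133211322112211213322112"; "312211322212221121123222112";
    "111312211312113221133211322112211213322112";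
    "1321132122211322212221121123222112"; "3113112211322112211213322112";
    "111312212221121123222112"; "132112211213322112"; "31121123222112";
    "111213322112"; "123222112"; "3113322112"; "1113222112"; "1322112";
    "311311222112"; "1113122112"; "132112"; "3112"; "1112"; "12";
    "3113112221133112"; "11131221131112"; "13211312"; "31132"; "111311222112";
    "13122112"; "32112"; "11133112"; "131112"; "312"; "13221133122211332";
    "31131122211311122113222"; "11131221131211322113322112";
    "13211321222113222112"; "3113112211322112"; "11131221222112";
    "1321122112"; "3112112"; "1112133"; "12322211331222113112211";
    "1113122113322113111221131221"; "13211322211312113211"; "311322113212221";
    "132211331222113112211"; "311311222113111221131221"; "111312211312113211";
    "132113212221"; "3113112211"; "11131221"; "13211"; "3112221";
    "1322113312211"; "311311222113111221"; "11131221131211"; "13211321";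
    "311311"; "11131"; "1321133112"; "31131112"; "111312"; "132"; "311332";
    "1113222"; "13221133112"; "3113112221131112"; "111312211312"; "1321132";
    "311311222"; "11131221133112"; "1321131112"; "311312"; "11132";
    "13112221133211322112211213322113"; "312211322212221121123222113";
    "111312211312113221133211322112211213322113";
    "1321132122211322212221121123222113"; "3113112211322112211213322113";
    "111312212221121123222113"; "132112211213322113"; "31121123222113";
    "111213322113"; "123222113"; "3113322113"; "1113222113"; "1322113";
    "311311222113"; "1113122113"; "132113"; "3113"; "1113"; "13"; "3"]%string.

Fact size_periodic_table : size periodic_table = 92 /\ uniq periodic_table.
Proof. by split; vm_compute. Qed.

(* Going down from uranium, each element occurs in the JHC-image of the
   preceding one, as in Conway's table. *)
Fact periodic_table_decay :
  sorted (fun E F => infix E (JHC F)) periodic_table.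
Proof. by vm_compute. Qed.

Definition common (E : seq nat) : Prop := E \in periodic_table.

Definition transuranic (E : seq nat) : Prop :=
  exists2 n, 4 <= n &
    E = rcons (letters "1311222113321132211221121332211") n \/
    E = rcons (letters "31221132221222112112322211") n.

(* Main.v *)
From Stdlib Require Import Strings.String.
From HB Require Import structures.
Require Import Defs.
From mathcomp Require Import all_boot.

Set Implicit Arguments.
Unset Strict Implicit.
Unset Printing Implicit Defensive.

(** Two nonempty words split as [L.R] as soon as the last letter of [L], which
    [JHC] never changes, is never the first letter of a word [iter n JHC R]
    ([apart_splits]).  Following the first letters of [R] from day to day gives
    a test on at most six letters of [R], stable under [JHC], that guarantees
    this: the predicate [cut] ([cut_apart]).  All the splittings below come from
    it, except those behind a letter that is at least 4.

    After one day no run is longer than 3 ([tame_JHC]), so no letter above 3 is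
    ever created again, and the word splits after each block of a letter
    [n >= 4] ([big_cut_apart]).  The chunks contain at most one such letter, in
    final position, and [JHC] commutes with renaming it ([iter_JHC_map]): from
    day one on it suffices to treat words over the letters 1, 2, 3, 4 in which 4
    is followed by nothing but 4 ([base]).

    The theorem is then a finite search.  Take such a word, run [JHC] on it ten
    times and break the result at every [cut].  A piece is read from right to
    left.  The letters already read determine letters of the words of the nine
    previous days and of the initial word; a reading is abandoned when one of
    those words is impossible, for instance because two adjacent runs would
    carry the same letter.  This backward reconstruction is the type [trace] with
    its transition function [step], and [step_traced] says that it never loses an
    actual word.  The piece also ends to the left at the first [cut].  Both
    constraints together leave finitely many pieces, each of which, broken at its
    cuts every day, becomes a compound of table elements within eighteen further
    days ([search_succeeds], [search_allP]).  The total is 1 + 10 + 18 = 29 days.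

    It remains to know that the table elements are atoms: for every proper
    factorization [L R] of one of them, the last letter of [L] is the first letter
    of [R] within eight days ([table_indivisible], [table_atom]). *)

(** * Run decompositions and splittings *)

Definition wf_runs (rs : seq (nat * nat)) :=
  all (fun p => 0 < p.1) rs && sorted (fun p q => p.2 != q.2) rs.

Definition unruns (rs : seq (nat * nat)) := flatten [seq nseq p.1 p.2 | p <- rs].

Definition spell (rs : seq (nat * nat)) := flatten [seq [:: p.1; p.2] | p <- rs].

Definition fresh a (w : seq nat) := if w is b :: _ then b != a else true.

Lemma unruns_cat rs1 rs2 : unruns (rs1 ++ rs2) = unruns rs1 ++ unruns rs2.
Proof. by rewrite /unruns map_cat flatten_cat. Qed.

Lemma spell_cat rs1 rs2 : spell (rs1 ++ rs2) = spell rs1 ++ spell rs2.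
Proof. by rewrite /spell map_cat flatten_cat. Qed.

Lemma JHC_spell w : JHC w = spell (runs w). Proof. by []. Qed.

Lemma runsK w : unruns (runs w) = w.
Proof. by have [] := runs_spec w. Qed.

Lemma wf_runs_runs w : wf_runs (runs w).
Proof. by have [_ ? ?] := runs_spec w; apply/andP. Qed.

Lemma wf_runs_catl rs1 rs2 : wf_runs (rs1 ++ rs2) -> wf_runs rs1.
Proof. by rewrite /wf_runs all_cat -andbA => /and3P[-> _ /cat_sorted2[->]]. Qed.

Lemma wf_runs_catr rs1 rs2 : wf_runs (rs1 ++ rs2) -> wf_runs rs2.
Proof. by rewrite /wf_runs all_cat -andbA => /and3P[_ -> /cat_sorted2[_ ->]]. Qed.

Lemma runs_consE a w : runs (a :: w) =
  if runs w is (m, b) :: rs then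
    if a == b then (m.+1, b) :: rs else [:: (1, a), (m, b) & rs]
  else [:: (1, a)].
Proof. by []. Qed.

Lemma runs_cons a w : exists m rs, runs (a :: w) = (m.+1, a) :: rs.
Proof.
rewrite /=; case: (runs w) => [|[m b] rs]; first by exists 0, [::].
by case: eqP => [->|_]; [exists m, rs | exists 0, ((m, b) :: rs)].
Qed.

Lemma runs_nseq m a w : fresh a w -> runs (nseq m.+1 a ++ w) = (m.+1, a) :: runs w.
Proof.
move=> aw; elim: m => [|m IHm]; last first.
  by rewrite -[nseq m.+2 a ++ w]/(a :: (nseq m.+1 a ++ w)) runs_consE IHm eqxx.
rewrite [LHS]/=; case: w aw => // b w /= ba; have [m [rs /= ->]] := runs_cons b w.
by rewrite eq_sym (negPf ba).
Qed.

Lemma JHC_nseq m a w : fresh a w -> JHC (nseq m.+1 a ++ w) = [:: m.+1, a & JHC w].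
Proof. by move=> aw; rewrite JHC_spell runs_nseq. Qed.

Lemma fresh_unruns m a rs : wf_runs ((m, a) :: rs) -> fresh a (unruns rs).
Proof.
case: rs => [|[[|m'] b] rs] //=; rewrite /wf_runs /= ?andbF //.
by rewrite eq_sym => /and3P[].
Qed.

Lemma unrunsK rs : wf_runs rs -> runs (unruns rs) = rs.
Proof.
elim: rs => [|[[|m] a] rs IHrs] // wf.
rewrite -[unruns _]/(nseq m.+1 a ++ unruns rs) runs_nseq ?(fresh_unruns wf) //.
by rewrite IHrs // (wf_runs_catr (rs1 := [:: (m.+1, a)])).
Qed.

Lemma JHC_unruns rs : wf_runs rs -> JHC (unruns rs) = spell rs.
Proof. by move=> wf; rewrite JHC_spell unrunsK. Qed.

Lemma JHC_nil w : (JHC w == [::]) = (w == [::]).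
Proof. by case: w => // a w; have [m [rs E]] := runs_cons a w; rewrite JHC_spell E. Qed.

Lemma iter_JHC_nil n w : (iter n JHC w == [::]) = (w == [::]).
Proof. by elim: n => // n; rewrite iterS JHC_nil. Qed.

Lemma last_unruns rs m a : wf_runs (rcons rs (m, a)) ->
  last 0 (unruns (rcons rs (m, a))) = a.
Proof.
rewrite -cats1 => /wf_runs_catr; rewrite unruns_cat last_cat {2}/unruns /= cats0.
rewrite /wf_runs /= !andbT.
by case: m => //= m _; elim: m.
Qed.

Lemma last_JHC w : last 0 (JHC w) = last 0 w.
Proof.
rewrite -{2}(runsK w) JHC_spell; have := wf_runs_runs w.
case/lastP: (runs w) => // rs [m a] wf.
by rewrite last_unruns // -cats1 spell_cat last_cat.
Qed.

Lemma last_iter_JHC n w : last 0 (iter n JHC w) = last 0 w.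
Proof. by elim: n => // n IHn; rewrite iterS last_JHC. Qed.

Lemma spell_inj : injective spell.
Proof.
elim=> [|[m a] rs IHrs] [|[m' a'] rs'] //=.
by rewrite /spell /= => -[-> -> /IHrs ->].
Qed.

Lemma runs_cat L R : L != [::] -> R != [::] -> last 0 L != head 0 R ->
  runs (L ++ R) = runs L ++ runs R.
Proof.
elim: L => // a [|b L] IHL _ R0.
  case: R R0 {IHL} => // c R _ /= ac; have [m [rs /= ->]] := runs_cons c R.
  by rewrite (negPf ac).
move=> /(IHL isT R0) E; rewrite -[(a :: b :: L) ++ R]/(a :: ((b :: L) ++ R)).
rewrite !(runs_consE a) E; have [m [rs ->]] := runs_cons b L.
by rewrite cat_cons; case: eqP.
Qed.

Lemma JHC_cat L R : L != [::] -> R != [::] -> last 0 L != head 0 R ->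
  JHC (L ++ R) = JHC L ++ JHC R.
Proof. by move=> L0 R0 LR; rewrite !JHC_spell runs_cat // spell_cat. Qed.

(** [spell] is injective, so additivity of [JHC] forces the run decompositions
    to concatenate, and no two adjacent runs share their letter. *)
Lemma JHC_cat_neq L R : L != [::] -> R != [::] ->
  JHC (L ++ R) = JHC L ++ JHC R -> last 0 L != head 0 R.
Proof.
move=> L0 R0; rewrite !JHC_spell -spell_cat => /spell_inj E.
have := wf_runs_runs (L ++ R); rewrite E.
case: R R0 {E} => // b R _; have [m [rs ->]] := runs_cons b R.
rewrite -[in last 0 L](runsK L).
have: runs L != [::] by apply: contra L0 => /eqP EL; rewrite -(runsK L) EL.
have := wf_runs_runs L.
case/lastP: (runs L) => // rs' [n a] wf _.
rewrite last_unruns // cat_rcons => /wf_runs_catr.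
by rewrite /wf_runs /= => /and3P[_ ab _].
Qed.

(** This refers to all days at once, so it is not decidable as it stands; [cut]
    and [big_cut] below are decidable conditions that imply it. *)
Definition apart x R := R != [::] /\ forall n, x != head 0 (iter n JHC R).

(** The last letter of [L] is the last letter of every [iter n JHC L], so no run
    ever straddles the border. *)
Lemma apart_splits L R : L != [::] -> apart (last 0 L) R -> splits L R.
Proof.
move=> L0 [R0 LR]; elim=> // n IHn.
by rewrite !iterS IHn JHC_cat ?iter_JHC_nil // last_iter_JHC.
Qed.

Lemma splits_apart L R n : L != [::] -> R != [::] -> splits L R ->
  last 0 L != head 0 (iter n JHC R).
Proof.
move=> L0 R0 LR; rewrite -(last_iter_JHC n L); apply: JHC_cat_neq; rewrite ?iter_JHC_nil //.
by rewrite -LR -!iterS.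
Qed.

(** [c x E] is a test allowing a cut between a word that ends with [x] and a
    following word [E]. *)
Definition chain (c : nat -> seq nat -> bool) (Es : seq (seq nat)) :=
  all (fun E => E != [::]) Es && sorted (fun E E' => c (last 0 E) E') Es.

(** Only the first letters of the next piece matter for the border in front of
    it, so pairwise splittings add up to a splitting into all the pieces. *)
Lemma chain_iter c Es :
    chain c Es -> (forall x E, E \in Es -> c x E -> apart x E) ->
  forall n, iter n JHC (flatten Es) = flatten [seq iter n JHC E | E <- Es].
Proof.
elim: Es => [_ _ |E Es IHEs]; first by elim=> // n; rewrite iterS => ->.
rewrite /chain /= => /andP[/andP[E0 Es0] sEs] cut_apart n.
have {}IHEs : forall n, iter n JHC (flatten Es) = flatten [seq iter n JHC E | E <- Es].
  apply: IHEs; first by rewrite /chain Es0 (path_sorted sEs).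
  by move=> x E' EsE'; apply: cut_apart; rewrite inE EsE' orbT.
case: Es Es0 sEs cut_apart IHEs => [|E' Es] /=; first by rewrite !cats0.
move=> /andP[E'0 _] /andP[cE _] cut_apart IHEs; rewrite -IHEs; apply: apart_splits => //.
have [] := cut_apart _ E' _ cE; first by rewrite !inE eqxx orbT.
move=> _ EE'; split; first by case: (E') E'0.
move=> m; rewrite IHEs; have := EE' m; have := iter_JHC_nil m E'; rewrite (negPf E'0).
by case: (iter m JHC E').
Qed.

(** The cut in front of [E] is decided when [E] itself is already free of cuts;
    hence the reading from right to left. *)
Fixpoint pieces (c : nat -> seq nat -> bool) (w : seq nat) : seq (seq nat) :=
  if w is x :: w' then
    if pieces c w' is E :: Es then
      if c x E then [:: x] :: E :: Es else (x :: E) :: Es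
    else [:: [:: x]]
  else [::].

Lemma flatten_pieces c w : flatten (pieces c w) = w.
Proof.
elim: w => //= x w; case: (pieces c w) => [<- //|E Es IHw].
by case: ifP => _ /=; rewrite -IHw.
Qed.

Lemma chain_pieces c w : chain c (pieces c w).
Proof.
elim: w => //= x w; case: (pieces c w) => [//|E Es IHw].
case: ifP => [cx|_].
  by move: IHw; rewrite /chain /= cx => /andP[-> ->].
move: IHw; rewrite /chain /= => /andP[/andP[E0 ->]] /=.
by case: Es => //= E' Es; case: E E0.
Qed.

Lemma pieces_iter c w : (forall x E, E \in pieces c w -> c x E -> apart x E) ->
  forall n, iter n JHC w = flatten [seq iter n JHC E | E <- pieces c w].
Proof.
by move=> cw n; rewrite -{1}(flatten_pieces c w); apply: chain_iter (chain_pieces c w) cw n.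
Qed.

(** * A splitting criterion stable under the audioactive operator *)

(** Words beginning with 1^1 X^1, with 1^3, or with 3^1 X^j for j < 3.  Under
    [JHC] each of these shapes passes to the next one cyclically, so that the
    first letter stays in {1, 3}.  The words 3 and 4 join the cycle after one day,
    as 13 and 14.  The definition is by matching, and on [eqn], because it is
    evaluated very often in the search. *)
Definition calm (w : seq nat) : bool :=
  match w with
  | 1 :: 1 :: 1 :: w' => if w' is z :: _ then ~~ eqn z 1 else true
  | 1 :: 1 :: _ => false
  | 1 :: y :: w' => if w' is z :: _ then ~~ eqn z y else true
  | [:: 3] | [:: 4] => true
  | 3 :: 3 :: _ => false
  | 3 :: y :: z :: w' =>
      if eqn z y then if w' is t :: _ then ~~ eqn t y else true else true
  | 3 :: _ => true
  | _ => false
  end.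

(** Conway's splitting criterion.  Behind a letter 2 the word must never begin
    with 2, which [calm] ensures; behind another letter it begins with 22 forever,
    because the initial run 22 reproduces itself as long as what follows never
    begins with 2. *)
Definition cut (x : nat) (w : seq nat) : bool :=
  match w with
  | 2 :: w' =>
      if eqn x 2 then false else
      match w' with [:: 2] => true | 2 :: w'' => calm w'' | _ => false end
  | _ => if eqn x 2 then calm w else false
  end.

Variant calm_spec : seq nat -> Prop :=
  | Calm111 w of fresh 1 w : calm_spec [:: 1, 1, 1 & w]
  | Calm1 y w of y != 1 & fresh y w : calm_spec [:: 1, y & w]
  | Calm3 j y w of j < 2 & y != 3 & fresh y w : calm_spec (3 :: nseq j.+1 y ++ w)
  | Calm3nil : calm_spec [:: 3]
  | Calm4nil : calm_spec [:: 4].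

Lemma calmP w : calm w -> calm_spec w.
Proof.
case: w => [|[|[|[|[|[|a]]]]] w] //.
- case: w => [|[|[|y]] w] // cw; [exact: Calm1| |exact: Calm1].
  by case: w cw => [|[|[|y]] w] // cw; apply: Calm111.
- case: w => [_|y w]; first exact: Calm3nil.
  have [->|y3] := eqVneq y 3; first by [].
  move=> cw; have {}cw : if w is z :: w' then
      if eqn z y then if w' is t :: _ then ~~ eqn t y else true else true else true.
    by case: y y3 cw => [|[|[|[|y]]]]; case: w.
  case: w cw => [_|z w]; first exact: (@Calm3 0 y [::]).
  case: ifP => [/eqnP -> cw | zy _]; first exact: (@Calm3 1 y w).
  by apply: (@Calm3 0 y (z :: w)) => //=; rewrite -eqnE zy.
- by case: w => // _; exact: Calm4nil.
Qed.

Lemma calm_1 y w : y != 1 -> fresh y w -> calm [:: 1, y & w].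
Proof. by case: y => [|[|y]] //; case: w. Qed.

Lemma calm_JHC w : calm w -> calm (JHC w).
Proof.
case/calmP => {w} // [w w1|y w y1 yw|j y w j2 y3 yw].
- rewrite (JHC_nseq 2 w1); case: w w1 => [|a w] //= a1.
  have [m [rs]] := runs_cons a w; rewrite JHC_spell => ->.
  by rewrite /spell /=; case: m => [|m] //=; rewrite eqnE.
- have y1w : fresh 1 (y :: w) by [].
  by rewrite (JHC_nseq 0 y1w) (JHC_nseq 0 yw) /=; case: y y1 {yw y1w} => [|[|y]].
- have y3w : fresh 3 (nseq j.+1 y ++ w) by [].
  rewrite (JHC_nseq 0 y3w) (JHC_nseq j yw); apply: calm_1 => //=.
  by case: j j2 {y3w} => [|[|j]].
Qed.

Lemma calm_head w : calm w -> (w != [::]) && (head 0 w != 2).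
Proof. by case: w => [|[|[|[|a]]] w]. Qed.

Lemma fresh_head a w : w != [::] -> fresh a w = (head 0 w != a).
Proof. by case: w. Qed.


Variant cut_spec x : seq nat -> Prop :=
  | Cut2 w of x = 2 & calm w : cut_spec x w
  | Cut22 of x != 2 : cut_spec x [:: 2; 2]
  | Cut22calm w of x != 2 & calm w : cut_spec x [:: 2, 2 & w].

Lemma cutP x w : cut x w -> cut_spec x w.
Proof.
case: (eqVneq x 2) => [->|x2] cw.
  by apply: Cut2 => //; case: w cw => [|[|[|[|a]]] w].
case: w cw => [|[|[|[|a]]] w]; rewrite /cut !eqnE ?(negPf x2) //.
case: w => [|[|[|[|a]]] w] //; case: w => [_|b w cw]; first exact: Cut22.
exact: Cut22calm.
Qed.

Lemma cut2 w : calm w -> cut 2 w.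
Proof. by case: w => [|[|[|[|a]]] w]. Qed.

Lemma cut22 x w : x != 2 -> (w == [::]) || calm w -> cut x [:: 2, 2 & w].
Proof. by move=> x2; rewrite /cut eqnE (negPf x2); case: w. Qed.

Lemma cut_JHC x w : cut x w -> cut x (JHC w).
Proof.
case/cutP => {w} [w -> /calm_JHC/cut2 // | x2 | w x2 cw]; first exact: cut22.
have /andP[w0 w2] := calm_head cw.
by rewrite (@JHC_nseq 1) ?cut22 ?calm_JHC ?orbT ?fresh_head.
Qed.

Lemma cut_head x w : cut x w -> (w != [::]) && (x != head 0 w).
Proof.
by case/cutP => {w} [w -> /calm_head/andP[-> ] /=|//|//]; rewrite eq_sym.
Qed.

Lemma cut_apart x w : cut x w -> apart x w.
Proof.
move=> cw; have cn n : cut x (iter n JHC w) by elim: n => // n /cut_JHC.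
by split=> [|n]; [have /cut_head/andP[] := cw | have /cut_head/andP[] := cn n].
Qed.


Lemma calm_take n w : calm w -> calm (take n.+3 w).
Proof.
case/calmP => {w} // [w w1|y w y1 yw|[|[|j]] y w // _ y3 yw].
- by case: w w1 => [|z w] //=; case: n => [|n] //=; rewrite eqnE.
- by apply: calm_1 => //; case: w yw.
- case: y y3 yw => [|[|[|[|y]]]] //=; case: w => [|z w] //= _; rewrite eqnE => /negPf-> //.
- case: y y3 yw => [|[|[|[|y]]]] //=; case: n => [|n]; case: w => [|z w] //= _;
    by rewrite ?eqxx ?eqnE ?eqxx.
Qed.

(** The criterion is decided by few letters: this is what the search uses as
    look-ahead to the right of a piece. *)
Lemma cut_take n x w : cut x w -> cut x (take n.+1.+4 w).
Proof.
case/cutP => {w} [w -> cw|/cut22->//|w x2 cw]; first by rewrite cut2 ?calm_take.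
by apply: cut22 => //; rewrite calm_take ?orbT.
Qed.

Lemma cut_fresh x w : cut x w -> fresh x w.
Proof. by move/cut_head/andP => [w0 xw]; rewrite fresh_head // eq_sym. Qed.

(** The test on a short piece [E] could be spoilt by what follows it; it is not,
    because the cut between [E] and [R] controls the first letters of [R].  The
    exception is the one-letter word 4. *)
Lemma calm_cat E R : calm E -> cut (last 0 E) R -> E != [:: 4] -> calm (E ++ R).
Proof.
case/calmP => {E} // [w w1|y w y1 yw|[|[|j]] y w // _ y3 yw|] cR _.
- case: w w1 cR => [|z w] /= w1; last by rewrite eqnE w1.
  by move/cut_fresh; case: R => //= b R; rewrite eqnE.
- case: w yw cR => [|z w] /= yw; last by move=> _; apply: (@calm_1 y (z :: w ++ R)).
  by move/cut_fresh => yR; apply: (@calm_1 y R).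
- case: w yw cR => [|z w] /= yw cR.
    move/cut_fresh: cR yw; case: y y3 => [|[|[|[|y]]]] //=;
      by case: R => //= b R _; rewrite eqnE => /negPf->.
  by case: y y3 yw cR => [|[|[|[|y]]]] //= _; rewrite eqnE => /negPf->.
- case: w yw cR => [|z w] /= yw cR.
    move/cut_fresh: cR yw; case: y y3 => [|[|[|[|y]]]] //=;
      by case: R => //= b R _; rewrite eqnE ?eqxx.
  by case: y y3 yw cR => [|[|[|[|y]]]] //= _; rewrite !eqnE eqxx.
- case/cutP: cR => // w _ /calm_head/andP[w0 w2] /=.
  by case: w w0 w2 => //= z w _; rewrite eqnE.
Qed.

Lemma cut_cat x E R : cut x E -> cut (last 0 E) R -> last 0 E != 4 -> cut x (E ++ R).
Proof.
case/cutP => {E} [E -> cE|x2 /=|E x2 cE] cR E4.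
- by apply/cut2/calm_cat => //; apply: contraNneq E4 => ->.
- by apply: cut22 => //; case/cutP: cR => // w _ ->; rewrite orbT.
have /andP[E0 _] := calm_head cE.
apply: cut22 => //; apply/orP; right; apply: calm_cat cE _ _.
  by case: E E0 cR {E4}.
by apply: contraNneq E4 => ->.
Qed.

(** * Runs of length at most three, and renaming of letters *)

(** No letter occurs four times in a row. *)
Definition tame (w : seq nat) := all (fun a => ~~ infix (nseq 4 a) w) w.

Lemma tameP w : reflect (forall a, ~~ infix (nseq 4 a) w) (tame w).
Proof.
apply: (iffP allP) => tw a => [|_]; last exact: tw.
have [/tw//|aw] := boolP (a \in w).
by apply: contra (aw) => /mem_infix; apply; rewrite inE eqxx.
Qed.

Lemma tame_infix E w : infix E w -> tame w -> tame E.
Proof.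
move=> Ew /tameP tw; apply/tameP => a; apply: contra (tw a) => aE.
exact: infix_trans aE Ew.
Qed.

Lemma tame_runs w p : tame w -> p \in runs w -> p.1 <= 3.
Proof.
case: p => m a /tameP tw wp; rewrite leqNgt; apply: contra (tw a) => /= m4.
have: infix (nseq m a) w.
  rewrite -(runsK w); case/splitPr: wp => rs1 rs2.
  by rewrite unruns_cat; apply/infixP; exists (unruns rs1), (unruns rs2).
apply: infix_trans; apply/infixP; exists [::], (nseq (m - 4) a).
by rewrite -[in LHS](subnKC m4) nseqD.
Qed.

(** Four equal consecutive letters in a word m1 a1 m2 a2 ... would contain two
    consecutive run letters a_i = a_(i+1). *)
Lemma tame_JHC w : tame (JHC w).
Proof.
apply/tameP => a; rewrite JHC_spell.
have /andP[_] := wf_runs_runs w; elim: (runs w) => // [[m b] rs] IHrs wf.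
rewrite -[spell _]/[:: m, b & spell rs] !infix_consl !negb_or.
rewrite IHrs ?(path_sorted wf) // andbT.
case: rs wf {IHrs} => [|[m1 b1] [|[m2 b2] rs]] /= wf; rewrite ?andbF ?andbT //.
  apply/negP => /and4P[_ /eqP ab _ /eqP ab1].
  by move: wf; rewrite -ab -ab1 eqxx.
apply/andP; split; apply/negP;
  [case/and4P=> _ /eqP ab _ /eqP ab1 | case/and4P=> /eqP ab _ /eqP ab1 _];
  by move: wf; rewrite -ab -ab1 eqxx.
Qed.

Section Rename.
Variables (f : nat -> nat) (f_inj : injective f).

Lemma runs_map w : runs (map f w) = [seq (p.1, f p.2) | p <- runs w].
Proof.
elim: w => // a w IHw; rewrite map_cons !runs_consE IHw.
by case: (runs w) => //= -[m b] rs; rewrite (inj_eq f_inj); case: eqP.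
Qed.

Lemma tame_map w : tame (map f w) = tame w.
Proof.
rewrite /tame all_map; apply: eq_all => a.
transitivity (~~ infix (map f (nseq 4 a)) (map f w)); first by [].
congr (~~ _); apply/infixP/infixP => -[A [B]]; last first.
  by move=> ->; exists (map f A), (map f B); rewrite !map_cat.
move=> E; exists (take (size A) w), (drop (size A + 4) w).
apply: (inj_map f_inj).
rewrite !map_cat map_take map_drop {2}E take_size_cat //.
have -> : drop (size A + 4) (map f w) = B by rewrite E catA drop_size_cat // size_cat.
exact: E.
Qed.

Hypothesis f_small : forall m, 0 < m -> m <= 3 -> f m = m.

(** [JHC] treats letters and run lengths alike, so a renaming commutes with it
    only when it fixes the run lengths that occur. *)
Lemma JHC_map w : tame w -> JHC (map f w) = map f (JHC w).
Proof.
move=> tw; rewrite !JHC_spell runs_map.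
have: {in runs w, forall p, f p.1 = p.1}.
  have /andP[/allP p0 _] := wf_runs_runs w.
  by move=> p wp; apply: f_small; [apply: p0 | apply: tame_runs tw wp].
elim: (runs w) => //= p rs IHrs frs.
rewrite -![spell (_ :: _)]/([:: _, _ & spell _]) /= frs ?inE ?eqxx // -IHrs // => q rsq.
by rewrite frs // inE rsq orbT.
Qed.

Lemma iter_JHC_map n w : tame w -> iter n JHC (map f w) = map f (iter n JHC w).
Proof.
move=> tw; elim: n => // n IHn; rewrite !iterS IHn JHC_map //.
by case: (n) => // m; rewrite iterS tame_JHC.
Qed.

End Rename.

(** An involution is used so that the renaming can be undone even if both 4 and
    [n] occur. *)
Definition swap4 n x := if x == 4 then n else if x == n then 4 else x.

Lemma swap4K n : involutive (swap4 n).
Proof.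
rewrite /swap4 => x; have [->|x4] := eqVneq x 4; rewrite ?eqxx.
  by case: eqP.
by have [->|xn] := eqVneq x n; rewrite ?eqxx // (negPf x4) (negPf xn).
Qed.

Lemma swap4_small n m : 4 <= n -> m <= 3 -> swap4 n m = m.
Proof.
move=> n4 m3; rewrite /swap4 !ltn_eqF //; exact: leq_ltn_trans m3 _.
Qed.

(** The words to which the theorem is reduced: 4 stands for the only letter above
    3, and once it occurs only 4 follows. *)
Definition base (w : seq nat) :=
  [&& all (fun x => 1 <= x <= 4) w, sorted (fun x y => (4 <= x) ==> (y == x)) w & tame w].

(** The form of a [base] word after at least one day: the final run of 4's has
    become a single 4. *)
Fixpoint strict (w : seq nat) : bool :=
  if w is x :: w' then
    if w' is [::] then 1 <= x <= 4 else (1 <= x <= 3) && strict w'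
  else true.

Lemma strict_catr L R : strict (L ++ R) -> strict R.
Proof.
elim: L => // a L IHL sLR; apply: IHL.
by move: sLR; rewrite cat_cons; case: (L ++ R) => //= b w /andP[].
Qed.

Lemma strict_catl L R : R != [::] -> strict (L ++ R) -> all (fun x => 1 <= x <= 3) L.
Proof.
by case: R => // b R _; elim: L => // a [|c L] IHL /=; rewrite ?andbT => /andP[-> /IHL].
Qed.

Lemma strict_base w : strict w -> tame w -> base w.
Proof.
rewrite /base => sw ->; rewrite andbT.
elim: w sw => //= a [|b w] IHw /=; first by move=> ->.
move=> /andP[/andP[a1 a3] /IHw/= /andP[-> ->]].
by rewrite a1 (leq_trans a3) //= ltnNge a3.
Qed.

Lemma strict_JHC w : base w -> strict (JHC w).
Proof.
case/and3P=> letw sw tw; rewrite JHC_spell.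
have: {in runs w, forall p, p.1 <= 3} by move=> p; apply: tame_runs.
move: letw sw {tw}; rewrite -{1 2}(runsK w); have := wf_runs_runs w.
elim: (runs w) => // -[[|m] a] rs IHrs wf //.
rewrite -[unruns _]/(nseq m.+1 a ++ unruns rs) all_cat.
move=> /andP[/andP[/andP[a1 a4] _] lrs] srs m3.
have m3' : m < 3 by apply: (m3 (m.+1, a)); rewrite inE eqxx.
rewrite -[spell _]/[:: m.+1, a & spell rs] /= m3' /=.
have wf' := wf_runs_catr (rs1 := [:: (m.+1, a)]) wf.
have/cat_sorted2[_ srs'] := srs.
have {}m3 : {in rs, forall p, p.1 <= 3} by move=> p rp; apply: m3; rewrite inE rp orbT.
have := IHrs wf' lrs srs' m3.
case: rs {IHrs lrs m3 wf' srs'} wf srs => [|[[|n] b] rs] wf srs.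
- by rewrite a1 a4.
- by move: wf; rewrite /wf_runs /= andbF.
rewrite -[spell _]/[:: n.+1, b & spell rs] => ->.
rewrite andbT a1 /= -ltnS ltn_neqAle a4 andbT.
apply: contraTneq wf => a4'; move: srs; rewrite a4' /=.
move=> srs; suff -> : b = 4 by rewrite /wf_runs /= andbF.
move: srs; rewrite -[unruns _]/(b :: (nseq n b ++ unruns rs)).
by elim: m {m3'} => [/= /andP[/eqP]|m IHm /= /IHm].
Qed.

Lemma base_JHC w : base w -> base (JHC w).
Proof. by move=> bw; rewrite strict_base ?strict_JHC ?tame_JHC. Qed.

(** * Splitting after large letters *)

(** From the next day on, the following word begins with a run length, hence with
    a letter at most 3; the inequality takes care of the current day. *)
Definition big_cut x (E : seq nat) := (4 <= x) && (x != head 0 E).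

Lemma head_JHC_le3 w : tame w -> head 0 (JHC w) <= 3.
Proof.
move=> tw; rewrite JHC_spell; case E: (runs w) => [|p rs] //=.
by apply: tame_runs tw _; rewrite E inE eqxx.
Qed.

Lemma big_cut_apart x E : E != [::] -> tame E -> big_cut x E -> apart x E.
Proof.
move=> E0 tE /andP[x4 xE]; split=> // -[|n] //; rewrite iterS.
have : tame (iter n JHC E) by case: n => // n; rewrite iterS tame_JHC.
by move/head_JHC_le3 => h3; rewrite neq_ltn (leq_ltn_trans h3 x4) orbT.
Qed.

Lemma pieces_infix c w E : E \in pieces c w -> infix E w.
Proof.
rewrite -{2}(flatten_pieces c w); case/splitPr => Es1 Es2.
by rewrite flatten_cat; apply/infixP; exists (flatten Es1), (flatten Es2).
Qed.

(** Inside a chunk no cut is allowed, so a letter above 3 is followed only by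
    copies of itself. *)
Lemma pieces_big_cut_sorted w C : C \in pieces big_cut w ->
  sorted (fun x y => (4 <= x) ==> (y == x)) C.
Proof.
elim: w C => // x w IHw C; rewrite /=; have := chain_pieces big_cut w.
case: (pieces big_cut w) IHw => [_ _|E Es IHw chainE]; first by rewrite inE => /eqP->.
have E0 : E != [::] by case/andP: chainE => /andP[].
case: ifP => [_|xE].
  by rewrite inE => /predU1P[->|/IHw].
rewrite inE => /predU1P[->|CEs]; last by apply: IHw; rewrite inE CEs orbT.
have: sorted (fun x y => (4 <= x) ==> (y == x)) E by apply: IHw; rewrite inE eqxx.
move: xE; rewrite /big_cut; case: E E0 {IHw chainE} => //= y E _ xy ->; rewrite andbT.
by case: leqP xy => //= _ /negbFE/eqP->.
Qed.

Lemma sorted_big_last C x : sorted (fun x y => (4 <= x) ==> (y == x)) C ->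
  x \in C -> 4 <= x -> x = last 0 C.
Proof.
elim: C => // y C IHC yC; rewrite inE => /predU1P[->|xC] x4; last first.
  by rewrite (IHC (path_sorted yC) xC x4); case: (C) xC.
move: x4; rewrite /=; elim: C yC {IHC} => //= z C IHC /andP[+ + y4].
rewrite y4 /= => /eqP->.
by move/IHC; apply.
Qed.

Lemma rename_chunk C : all (leq 1) C -> tame C ->
    sorted (fun x y => (4 <= x) ==> (y == x)) C ->
  exists2 n, 4 <= n & base (map (swap4 n) C).
Proof.
move=> posC tC sC; pose n := maxn 4 (last 0 C).
have n4 : 4 <= n by rewrite leq_maxl.
have swapC x : x \in C -> (x <= 3) && (swap4 n x == x) || (x == n) && (swap4 n x == 4).
  move=> Cx; case: (leqP x 3) => [x3|x4]; first by rewrite swap4_small ?eqxx.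
  have xlast := sorted_big_last sC Cx x4.
  have <- : x = n by rewrite /n -xlast; apply/esym/maxn_idPr.
  by apply/orP; right; rewrite /swap4 eqxx; case: (x =P 4) => [->|_]; rewrite ?eqxx.
exists n => //; rewrite /base tame_map ?tC ?andbT; last exact: inv_inj (swap4K n).
apply/andP; split.
  rewrite all_map; apply/allP => x Cx /=.
  have /orP[/andP[x3 /eqP->]|/andP[_ /eqP->]//] := swapC x Cx.
  by rewrite (allP posC) // leqW.
rewrite sorted_map; apply: sub_sorted sC => x y /= xy.
case: (leqP x 3) xy => [x3 _|_ /eqP->]; last by rewrite eqxx implybT.
by rewrite (swap4_small n4 x3) leqNgt ltnS x3.
Qed.

(** * Tracing a word back through its ancestors *)

(** What is known of the day-[j] word when it has been read from its right end down
    to some position, together with the days before it.  A known word contributes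
    its last letter read (0 if it was empty).  In [Later p h s], the flag [p] says
    that [h] is the letter of a pair (length, letter) whose length has not been
    read yet; [s] is the trace of the previous day, in which that run counts with
    one letter so far.  [Unknown] stands for a word of which nothing has been
    read. *)
Inductive trace := Unknown | Day0 of nat | Later of bool & nat & trace.

Lemma trace_comparable : comparable trace.
Proof.
elim=> [|h|p h s IHs] [|h'|p' h' s']; try by [left | right].
  by have [->|hh'] := eqVneq h h'; [left | right => -[/eqP]; apply/negP].
have [->|pp'] := eqVneq p p'; last by right => -[/eqP]; rewrite (negPf pp').
have [->|hh'] := eqVneq h h'; last by right => -[/eqP]; rewrite (negPf hh').
by case: (IHs s') => [->|ss']; [left | right => -[]].
Qed.

HB.instance Definition _ := hasDecEq.Build trace (compareP trace_comparable).

Definition clash x s :=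
  match s with Unknown => false | Day0 h => eqn h x | Later _ h _ => eqn h x end.

(** Reading one more letter [x], to the left.  If a run letter is expected, it must
    differ from the last letter read on the previous day, and one copy of it is
    read there; if a run length [x] is expected, [x - 1] further copies of the
    pending letter are read on the previous day.  For an [Unknown] word the parity
    is not determined either: [x] can be the length of a run whose letter has
    not been read, or a run letter.  Day 0 carries no constraint. *)
Fixpoint step (j : nat) (s : trace) (x : nat) : seq trace :=
  if j is j'.+1 then
    match s with
    | Unknown => Later false x Unknown :: map (Later true x) (step j' Unknown x)
    | Day0 _ => [::]
    | Later false _ s' => if clash x s' then [::] else map (Later true x) (step j' s' x)
    | Later true a s' =>
      match x with
      | 1 => [:: Later false 1 s']
      | 2 => map (Later false 2) (step j' s' a)
      | 3 => map (Later false 3) (flatten [seq step j' t a | t <- step j' s' a])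
      | _ => [::]
      end
    end
  else [:: Day0 x].

(** The words that exist on day [j], counted from an arbitrary [base] word. *)
Definition day j W := exists2 w, base w & W = iter j JHC w.

(** [traced j s P Q]: the word [P ++ Q] exists on day [j], its part [Q] has been read,
    and [s] is a correct trace of this.  On later days the position between [P] and
    [Q] lies either between two pairs (length, letter) or inside one pair, and it
    corresponds to a position in the word of the previous day: between the two
    runs, or just before the last letter of the run. *)
Inductive traced : nat -> trace -> seq nat -> seq nat -> Prop :=
| TracedUnknown j P Q of day j (P ++ Q) : traced j Unknown P Q
| TracedDay0 P Q of day 0 (P ++ Q) : traced 0 (Day0 (head 0 Q)) P Q
| TracedEven j s rs1 rs2 of wf_runs (rs1 ++ rs2) & traced j s (unruns rs1) (unruns rs2) :
    traced j.+1 (Later false (head 0 (spell rs2)) s) (spell rs1) (spell rs2)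
| TracedOdd j s rs1 m a rs2 of wf_runs (rs1 ++ (m.+1, a) :: rs2) &
    traced j s (unruns rs1 ++ nseq m a) (a :: unruns rs2) :
    traced j.+1 (Later true a s) (rcons (spell rs1) m.+1) (a :: spell rs2).

Lemma day_base j W : day j W -> base W.
Proof. by case=> w bw ->; elim: j => // j; rewrite iterS => /base_JHC. Qed.

Lemma day_strict j W : day j.+1 W -> strict W.
Proof. by case=> w bw ->; rewrite iterS strict_JHC // (@day_base j) //; exists w. Qed.

Lemma day_JHC j W : day j W -> day j.+1 (JHC W).
Proof. by case=> w bw ->; exists w. Qed.

Lemma nseq_rcons m (a : nat) : nseq m.+1 a = rcons (nseq m a) a.
Proof. by rewrite -cats1 -(nseqD m 1) addn1. Qed.

Lemma unruns_split rs1 m a rs2 :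
  unruns (rs1 ++ (m.+1, a) :: rs2) = (unruns rs1 ++ nseq m a) ++ a :: unruns rs2.
Proof.
rewrite unruns_cat -[unruns (_ :: _)]/(nseq m.+1 a ++ unruns rs2) -catA; congr (_ ++ _).
by rewrite -cat_rcons -nseq_rcons.
Qed.

Lemma traced_day j s P Q : traced j s P Q -> day j (P ++ Q).
Proof.
elim=> {j s P Q} // [j s rs1 rs2 wf _ | j s rs1 m a rs2 wf _].
  by rewrite -unruns_cat -spell_cat -JHC_unruns //; apply: day_JHC.
rewrite -unruns_split cat_rcons -[[:: m.+1, a & _]]/(spell ((m.+1, a) :: rs2)).
by rewrite -spell_cat -JHC_unruns //; apply: day_JHC.
Qed.

Lemma traced_clash j s P Q x : traced j s P Q -> clash x s -> x = head 0 Q.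
Proof. by case=> {j s P Q} //= *; apply/esym/eqnP. Qed.

Lemma spell_rcons rs P x : spell rs = rcons P x -> all (fun p => 0 < p.1) rs ->
  exists rs' m, rs = rcons rs' (m.+1, x) /\ P = rcons (spell rs') m.+1.
Proof.
case/lastP: rs => [|rs' [m a]]; first by case: P.
rewrite all_rcons -cats1 spell_cat -[spell [:: _]]/[:: m; a] -cat_rcons cats1.
by move=> /rcons_inj[<- <-] /andP[/= m0 _]; exists rs', m.-1; rewrite prednK // cats1.
Qed.

Lemma spell_split rs P x Q : spell rs = rcons P x ++ Q ->
  exists rs1 p rs2, rs = rs1 ++ p :: rs2 /\
  ([/\ x = p.1, P = spell rs1 & Q = p.2 :: spell rs2] \/
   [/\ x = p.2, P = rcons (spell rs1) p.1 & Q = spell rs2]).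
Proof.
elim: rs P => [|[m a] rs IHrs] [|y P] //=; rewrite -?[spell (_ :: _)]/[:: m, a & spell rs].
  by case=> -> <-; exists [::], (x, a), rs; split=> //; left.
case: P => [|z P] /= [-> ].
  by move=> -> <-; exists [::], (y, x), rs; split=> //; right.
move=> -> /IHrs[rs1 [p [rs2 [-> E]]]]; exists ((y, z) :: rs1), p, rs2; split=> //.
by case: E => -[-> -> ->]; [left | right].
Qed.

(** Completeness of the backward reconstruction: whatever letter precedes the
    part already read, some transition follows it. *)
Lemma step_traced j s P x Q : traced j s (rcons P x) Q ->
  exists2 s', s' \in step j s x & traced j s' P (x :: Q).
Proof.
have day_step i R y S : day i (rcons R y ++ S) -> day i (R ++ y :: S) by rewrite cat_rcons.
elim: j s P x Q => [|j IHj] s P x Q okPQ.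
  exists (Day0 x); first by rewrite inE.
  by apply: (@TracedDay0 P (x :: Q)); apply: day_step; apply: traced_day okPQ.
have push s1 R m a S : traced j s1 (R ++ nseq m.+1 a) S ->
    exists2 s2, s2 \in step j s1 a & traced j s2 (R ++ nseq m a) (a :: S).
  by move=> ok1; apply: IHj; rewrite rcons_cat -nseq_rcons.
move: {-2}(rcons P x) (erefl (rcons P x)) okPQ => P' EP okPQ.
inversion okPQ as [j' P1 Q1 dayW Ej Es EP1 EQ1|
  |j' s' rs1 rs2 wf oks Ej Es EP1 EQ1
  |j' s' rs1 m a rs2 wf oks Ej Es EP1 EQ1].
(* Both parities are possible, and each of them is one of the transitions. *)
- subst; have [w bw] := dayW; rewrite iterS JHC_spell; set W := iter j JHC w => /esym ES.
  have dayj : day j W by exists w.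
  have wf := wf_runs_runs W; have := runsK W.
  have [rs1 [[[|m] a] [rs2 [Ers]]]] := spell_split ES; rewrite Ers in wf *.
    by move: (wf_runs_catr wf); rewrite /wf_runs /=.
  move=> E EW; rewrite unruns_split in EW.
  case: E => -[-> -> ->].
    exists (Later false m.+1 Unknown); first by rewrite inE eqxx.
    rewrite -[[:: m.+1, a & _]]/(spell ((m.+1, a) :: rs2)).
    apply: (@TracedEven j Unknown rs1 ((m.+1, a) :: rs2)) => //.
    by apply: TracedUnknown; rewrite -unruns_cat unruns_split EW.
  have okU : traced j Unknown (unruns rs1 ++ nseq m.+1 a) (unruns rs2).
    by apply: TracedUnknown; rewrite nseq_rcons -rcons_cat cat_rcons EW.
  have [s2 s2U ok2] := push _ _ _ _ _ okU.
  exists (Later true a s2); first by rewrite inE map_f ?orbT.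
  exact: TracedOdd.
(* [x] is a run letter: move one letter into its run on the previous day. *)
- subst; have pos1 : all (fun p => 0 < p.1) rs1 by case/andP: (wf_runs_catl wf).
  have [rs [m [Ers EP']]] := spell_rcons EP1 pos1; subst rs1 P.
  have okx : traced j s' (unruns rs ++ nseq m.+1 x) (unruns rs2).
    by move: oks; rewrite -cats1 unruns_cat [unruns [:: _]]cats0.
  have [s2 s2x ok2] := push _ _ _ _ _ okx.
  have wf2 : wf_runs (rs ++ (m.+1, x) :: rs2) by rewrite -cat_rcons.
  exists (Later true x s2); last exact: TracedOdd.
  rewrite /=; case: ifP => [/(traced_clash okx) Ex|_]; last exact: map_f.
  have := fresh_unruns (wf_runs_catr wf2).
  have /day_base/and3P[/allP pos _ _] := traced_day ok2.
  have /andP[x0 _] : 0 < x <= 4 by apply: pos; rewrite mem_cat inE eqxx orbT.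
  by case: (unruns rs2) Ex x0 => [->|b w /= ->] //; rewrite eqxx.
(* [x] is a run length: move to the left end of the run on the previous day. *)
subst; have [EP EX] := rcons_inj EP1; subst P x.
have m3 : m.+1 <= 3.
  have /day_strict := traced_day okPQ; rewrite -cats1 => /strict_catl-/(_ isT).
  by rewrite all_cat => /andP[_ /andP[/andP[]]].
have {}okPQ s2 : traced j s2 (unruns rs1) (nseq m a ++ a :: unruns rs2) ->
    traced j.+1 (Later false m.+1 s2) (spell rs1) [:: m.+1, a & spell rs2].
  move=> ok2; apply: (@TracedEven j s2 rs1 ((m.+1, a) :: rs2)) => //.
  by rewrite -[unruns (_ :: _)]/(nseq m.+1 a ++ unruns rs2) nseq_rcons cat_rcons.
case: m m3 oks okPQ {wf EP1} => [|[|[|//]]] _ oks okPQ /=.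
- exists (Later false 1 s'); first by rewrite inE.
  by apply: okPQ; move: oks; rewrite cats0.
- have [s2 s2a ok2] := push _ _ _ _ _ oks; rewrite cats0 in ok2.
  by exists (Later false 2 s2); [exact: map_f | exact: okPQ].
- have [s2 s2a ok2] := push _ _ _ _ _ oks; have [s3 s3a ok3] := push _ _ _ _ _ ok2.
  rewrite cats0 in ok3; exists (Later false 3 s3); last exact: okPQ.
  by apply: map_f; apply/flatten_mapP; exists s2.
Qed.

(** Whether the left end of the word may have been reached: on no day may a run
    still be lacking its length. *)
Fixpoint may_start s := if s is Later p _ s' then if p then false else may_start s' else true.

Lemma traced_may_start j s Q : traced j s [::] Q -> may_start s.
Proof.
elim: j s Q => [|j IHj] s Q okQ; first by inversion okQ.
inversion okQ as [| |j' s' rs1 rs2 wf oks Ej Es EP1 EQ1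
  |j' s' rs1 m a rs2 wf oks Ej Es EP1 EQ1].
- by [].
- by case: rs1 EP1 oks {wf} => // _ /IHj.
- by case: (spell rs1) EP1.
Qed.

(** The trace at the right end of a word, where the ends of all the ancestors are
    aligned. *)
Fixpoint end_trace j := if j is j'.+1 then Later false 0 (end_trace j') else Day0 0.

Lemma traced_end_trace j W : day j W -> traced j (end_trace j) W [::].
Proof.
elim: j W => [|j IHj] W; first by move=> dW; apply: (@TracedDay0 W [::]); rewrite cats0.
case=> w bw ->; rewrite iterS JHC_spell.
apply: (@TracedEven j (end_trace j) _ [::]); first by rewrite cats0 wf_runs_runs.
by rewrite runsK; apply: IHj; exists w.
Qed.

Definition steps j (l : seq trace) x := flatten [seq step j s x | s <- l].

Lemma steps_traced j l s P x Q : s \in l -> traced j s (rcons P x) Q ->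
  exists2 s', s' \in steps j l x & traced j s' P (x :: Q).
Proof.
by move=> ls /step_traced[s' ss' traced']; exists s' => //; apply/flatten_mapP; exists s.
Qed.

Lemma foldr_steps_traced j l s P e Q : s \in l -> traced j s (P ++ e) Q ->
  exists2 s', s' \in foldr (fun x l => steps j l x) l e & traced j s' P (e ++ Q).
Proof.
elim: e P => [|x e IHe] P ls; first by rewrite cats0 => ?; exists s.
by rewrite -cat_rcons => /(IHe _ ls)[s' s'l traced']; apply: steps_traced s'l traced'.
Qed.

(** * Decay of concrete words *)

(** A one-pass form of [JHC] that carries the current run, for evaluation. *)
Fixpoint say (a m : nat) (w : seq nat) : seq nat :=
  if w is b :: w' then
    if eqn a b then say a m.+1 w' else [:: m, a & say b 1 w']
  else [:: m; a].

Definition jhc w := if w is a :: w' then say a 1 w' else [::].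

Lemma sayE a m w : say a m.+1 w = JHC (nseq m.+1 a ++ w).
Proof.
elim: w a m => [|b w IHw] a m; first by rewrite JHC_nseq.
rewrite /=; case: ifP => [/eqnP <-|ab].
  by rewrite IHw nseq_rcons cat_rcons.
by rewrite IHw (@JHC_nseq m a (b :: w)) //= eq_sym -eqnE ab.
Qed.

Lemma jhcE w : jhc w = JHC w.
Proof. by case: w => // a w; rewrite /jhc sayE. Qed.

(** Prefix trees over the letters 1, 2, 3, 4: membership in the table is tested a
    few hundred thousand times. *)
Inductive trie := Leaf | Node of bool & trie & trie & trie & trie.

Fixpoint lookup (w : seq nat) (t : trie) {struct t} : bool :=
  if t is Node b t1 t2 t3 t4 then
    match w with
    | [::] => b
    | 1 :: w' => lookup w' t1
    | 2 :: w' => lookup w' t2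
    | 3 :: w' => lookup w' t3
    | 4 :: w' => lookup w' t4
    | _ => false
    end
  else false.

Fixpoint add (t : trie) (w : seq nat) {struct w} : trie :=
  let: (b, t1, t2, t3, t4) :=
    if t is Node b t1 t2 t3 t4 then (b, t1, t2, t3, t4)
    else (false, Leaf, Leaf, Leaf, Leaf) in
  match w with
  | [::] => Node true t1 t2 t3 t4
  | 1 :: w' => Node b (add t1 w') t2 t3 t4
  | 2 :: w' => Node b t1 (add t2 w') t3 t4
  | 3 :: w' => Node b t1 t2 (add t3 w') t4
  | _ :: w' => Node b t1 t2 t3 (add t4 w')
  end.

Fixpoint members (t : trie) : seq (seq nat) :=
  if t is Node b t1 t2 t3 t4 then
    nseq b [::] ++ [seq 1 :: w | w <- members t1] ++ [seq 2 :: w | w <- members t2] ++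
      [seq 3 :: w | w <- members t3] ++ [seq 4 :: w | w <- members t4]
  else [::].

Lemma lookup_members w t : lookup w t -> w \in members t.
Proof.
elim: t w => // b t1 IH1 t2 IH2 t3 IH3 t4 IH4 [|[|[|[|[|[|x]]]]] w] //=.
- by move=> ->.
- by move/IH1 => tw; rewrite !mem_cat map_f ?orbT.
- by move/IH2 => tw; rewrite !mem_cat map_f ?orbT.
- by move/IH3 => tw; rewrite !mem_cat map_f ?orbT.
- by move/IH4 => tw; rewrite !mem_cat map_f ?orbT.
Qed.

Definition neptunium := letters "1311222113321132211221121332211"%string.
Definition plutonium := letters "31221132221222112112322211"%string.

(** The 94 target elements, with 4 as the final letter of the transuranic ones. *)
Definition table4 := rcons neptunium 4 :: rcons plutonium 4 :: periodic_table.

Definition table_trie := Eval vm_compute in foldl add Leaf table4.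

Lemma lookup_table w : lookup w table_trie -> w \in table4.
Proof.
move/lookup_members; apply/allP: w.
by vm_cast_no_check (erefl true).
Qed.

(** [compound_of] for an arbitrary property of the factors, without requiring them
    to be atoms or the word to be nonempty. *)
Definition splits_into (P : seq nat -> Prop) s :=
  exists2 Es, {in Es, forall E, P E} &
    forall n, iter n JHC s = flatten [seq iter n JHC E | E <- Es].

Lemma splits_into_flatten (P : seq nat -> Prop) t s Es :
    (forall n, iter n JHC s = flatten [seq iter n JHC E | E <- Es]) ->
    {in Es, forall E, splits_into P (iter t JHC E)} -> splits_into P (iter t JHC s).
Proof.
move=> sE EsP; suff [Fs FsP EF] : exists2 Fs, {in Fs, forall E, P E} &
    forall n, flatten [seq iter (n + t) JHC E | E <- Es] =
      flatten [seq iter n JHC F | F <- Fs].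
  by exists Fs => // n; rewrite -iterD sE EF.
elim: Es EsP {sE} => [_|E Es IHEs EsP]; first by exists [::].
have [|Fs FsP EF] := IHEs; first by move=> F EsF; apply: EsP; rewrite inE EsF orbT.
have [|Gs GsP EG] := EsP E; first by rewrite inE eqxx.
exists (Gs ++ Fs) => [F|n]; first by rewrite mem_cat => /orP[/GsP|/FsP].
by rewrite /= map_cat flatten_cat -EF -EG iterD.
Qed.

Lemma splits_into1 (P : seq nat -> Prop) E : P E -> splits_into P E.
Proof. by exists [:: E] => [F|n]; [rewrite inE => /eqP-> | rewrite /= cats0]. Qed.

Notation in_table := (fun E => E \in table4).

(** The table is closed under decay: the image of each element falls into table
    elements at its cuts. *)
Lemma table_JHC t E : E \in table4 -> splits_into in_table (iter t JHC E).
Proof.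
have table_step F : F \in table4 -> splits_into in_table (JHC F).
  move=> tF; exists (pieces cut (JHC F)); last first.
    by apply: pieces_iter => x G _; apply: cut_apart.
  have: all (fun F => all (lookup^~ table_trie) (pieces cut (JHC F))) table4.
    by vm_cast_no_check (erefl true).
  by move/allP/(_ F tF)/allP => tJ G /tJ/lookup_table.
elim: t => [|t IHt] tE; first exact: splits_into1.
have [Es EsP sE] := IHt tE; rewrite iterS; apply: (@splits_into_flatten _ 1) sE _.
by move=> F /EsP/table_step.
Qed.

Fixpoint decays (t : nat) (w : seq nat) : bool :=
  if lookup w table_trie then true else
  if t is t'.+1 then all (decays t') (pieces cut (jhc w)) else false.

Lemma decaysP t w : decays t w -> splits_into in_table (iter t JHC w).
Proof.
elim: t w => [|t IHt] w /=; case: ifP => [/lookup_table tw _|_] //.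
- exact: splits_into1.
- exact: (table_JHC t.+1).
rewrite jhcE => /allP Jw; rewrite -iterS iterSr.
apply: splits_into_flatten (fun E JE => IHt E (Jw E JE)).
by apply: pieces_iter => x G _; apply: cut_apart.
Qed.

(** * The search over pieces *)

(** All words of length at most [n] that can follow a piece: a 4 is final. *)
Fixpoint tails n : seq (seq nat) :=
  if n is n'.+1 then
    [:: [::], [:: 4] & [seq x :: e | x <- [:: 1; 2; 3], e <- tails n']]
  else [:: [::]].

Lemma tails_take n R : strict R -> take n R \in tails n.
Proof.
elim: n R => [|n IHn] [|x R] //= sR; rewrite !inE /=.
case: (eqVneq x 4) sR => [-> | x4] sR.
  by case: R sR.
have {sR} [x13 sR] : 1 <= x <= 3 /\ strict R.
  case: R sR => [|b R] /andP[]; last by move=> -> ->.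
  by move=> ->; rewrite leq_eqVlt (negPf x4).
rewrite orbC; have /IHn tR := sR.
by case: x x4 x13 => [|[|[|[|x]]]] // _ _; rewrite !mem_cat map_f ?orbT.
Qed.

Section Search.
Variables (k n t : nat).

(** The traces of the position in front of the look-ahead [e].  A look-ahead that
    is shorter than [n] or ends with 4 reaches the end of the word, which fixes
    all parities; otherwise nothing is known to the right of it. *)
Definition after (e : seq nat) : seq trace :=
  foldr (fun x l => steps k l x)
    [:: if (size e < n) || (last 0 e == 4) then end_trace k else Unknown] e.

(** The traces once the last letter [x] of a piece has been read, for every
    look-ahead that allows the piece to end there. *)
Definition seed (afters : seq (seq nat * seq trace)) (x : nat) : seq trace :=
  flatten [seq if nilp p.1 || cut x p.1 then steps k p.2 x else [::] | p <- afters].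

Definition extensions (l : seq trace) : seq (nat * seq trace) :=
  [seq p <- [seq (x, steps k l x) | x <- [:: 1; 2; 3]] | ~~ nilp p.2].

Lemma mem_extensions l x : 1 <= x <= 3 -> ~~ nilp (steps k l x) ->
  (x, steps k l x) \in extensions l.
Proof.
move=> x13 lx; rewrite mem_filter lx map_f //.
by case: x x13 {lx} => [|[|[|[|x]]]].
Qed.

(** [u] is the part of a piece read so far.  It can be the whole piece if the word
    may start there, or if some possible preceding letter [x] allows a cut; in
    that case [u] has to decay.  It is extended by the other letters. *)
Fixpoint search (d : nat) (u : seq nat) (l : seq trace) : bool :=
  if d is d'.+1 then
    let next := extensions l in
    if has may_start l || has (fun p => cut p.1 u) next ==> decays t u
    then all (fun p => if cut p.1 u then true else search d' (p.1 :: u) p.2) next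
    else false
  else false.

Lemma searchE d u l : search d.+1 u l =
  if has may_start l || has (fun p => cut p.1 u) (extensions l) ==> decays t u
  then all (fun p => if cut p.1 u then true else search d (p.1 :: u) p.2) (extensions l)
  else false.
Proof. by []. Qed.

Definition search_all d :=
  let afters := [seq (e, after e) | e <- tails n] in
  all (fun x => search d [:: x] (seed afters x)) [:: 1; 2; 3; 4].

(** The piece is [P2 ++ u]: the search has followed the actual letters of [P] up
    to the first cut. *)
Lemma searchP d u l s P R : search d u l -> s \in l -> u != [::] -> 0 < k ->
    traced k s P (u ++ R) ->
  exists P1 P2, [/\ P = P1 ++ P2, decays t (P2 ++ u) &
    P1 != [::] -> cut (last 0 P1) (P2 ++ u)].
Proof.
elim: d u l s P => // d IHd u l s P + ls u0 k0 oks.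
rewrite searchE; set next := extensions l; case: ifP => // dec_u all_next.
case/lastP: P oks => [|P x] oks.
  exists [::], [::]; split=> //; apply: (implyP dec_u).
  by apply/orP; left; apply/hasP; exists s => //; apply: traced_may_start oks.
have [s' s'l traced'] := steps_traced ls oks.
have xnext : (x, steps k l x) \in next.
  apply: mem_extensions; last by case: (steps k l x) s'l.
  have /day_strict : day k.-1.+1 (rcons P x ++ u ++ R).
    by rewrite prednK //; apply: traced_day oks.
  move/strict_catl; case: (u) u0 => // b u' _ /(_ isT)/allP; apply.
  by rewrite mem_rcons inE eqxx.
have /= := allP all_next _ xnext; case: ifP => [xu _|xu /(IHd)].
  exists (rcons P x), [::]; split; rewrite ?cats0 ?last_rcons //.
  by apply: (implyP dec_u); apply/orP; right; apply/hasP; exists (x, steps k l x).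
move=> /(_ s' P s'l isT k0 traced')[P1 [P2 [-> dec cP1]]].
by exists P1, (rcons P2 x); split; rewrite ?cat_rcons ?rcons_cat.
Qed.

Lemma mem_after P R : 0 < k -> day k (P ++ R) ->
  exists2 s, s \in after (take n R) & traced k s P R.
Proof.
move=> k0 dayPR; rewrite /after; set e := take n R.
have ->: R = e ++ drop n R by rewrite cat_take_drop.
apply: foldr_steps_traced (mem_head _ _) _; case: ifP => [e_end|_]; last first.
  by apply: TracedUnknown; rewrite -catA cat_take_drop.
have D : drop n R = [::].
  case/orP: e_end => [e_n | /eqP e4].
    apply: drop_oversize; move: e_n; rewrite size_take.
    by case: (ltnP n (size R)); rewrite ?ltnn // => _ /ltnW.
  apply/eqP; case: eqVneq => // D.
  move: dayPR; rewrite -[R](cat_take_drop n) -/e catA -(prednK k0).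
  move=> /day_strict/(strict_catl D).
  have Pe4 : 4 \in P ++ e.
    by rewrite mem_cat -e4; case: (e) e4 => //= a e' _; rewrite mem_last orbT.
  by move/allP/(_ 4 Pe4).
have eR : e = R by rewrite -[RHS](cat_take_drop n) D cats0.
by rewrite D eR; apply: traced_end_trace.
Qed.

Hypotheses (k_gt0 : 0 < k) (n_ge5 : 5 <= n).

Lemma seed_traced P x R : day k (rcons P x ++ R) -> nilp R || cut x R ->
  exists2 s, s \in seed [seq (e, after e) | e <- tails n] x & traced k s P (x :: R).
Proof.
move=> dayPR xR; have [s sR oks] := mem_after k_gt0 dayPR.
have [s' s's traced'] := steps_traced sR oks; exists s' => //.
apply/flatten_mapP; exists (take n R, after (take n R)).
  have sRn : strict R.
    by move: dayPR; rewrite -(prednK k_gt0) => /day_strict/strict_catr.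
  by apply: (map_f (fun e => (e, after e))); apply: tails_take.
rewrite /= ifT //; case/orP: xR => [|xR]; first by case: (R).
by case: n n_ge5 => [|[|[|[|[|n']]]]] // _; rewrite cut_take ?orbT.
Qed.

(** Pieces are detached from the right end.  The search only looks at a piece by
    itself, and [cut_cat] turns a cut in front of it into a cut in front of the
    whole remainder, as needed for the look-ahead of the next piece. *)
Lemma search_allP d S : search_all d -> day k S ->
  exists Es, [/\ S = flatten Es, chain cut Es & all (decays t) Es].
Proof.
move=> /allP searchd dayS.
suff: forall m P Es, size P <= m -> S = P ++ flatten Es -> chain cut Es ->
    all (decays t) Es ->
    (P != [::] -> Es != [::] ->
      cut (last 0 P) (head [::] Es) /\ cut (last 0 P) (flatten Es)) ->
  exists Es, [/\ S = flatten Es, chain cut Es & all (decays t) Es].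
  by move/(_ (size S) S [::]); apply; rewrite ?cats0.
elim=> [|m IHm] P Es; first by rewrite leqn0 size_eq0 => /eqP-> /= *; exists Es.
case/lastP: P => [|P x]; first by move=> _ /= *; exists Es.
rewrite size_rcons ltnS => Pm SE chainE decE cutE.
have xR : nilp (flatten Es) || cut x (flatten Es).
  case: (Es) cutE => // E Es' []; rewrite ?last_rcons //; first by case: (P).
  by move=> _ ->; rewrite orbT.
have dayPR : day k (rcons P x ++ flatten Es) by rewrite -SE.
have [s sx oks] := seed_traced dayPR xR.
have x14 : x \in [:: 1; 2; 3; 4].
  have /and3P[/allP/(_ x) + _ _] := day_base dayPR.
  rewrite mem_cat mem_rcons inE eqxx => /(_ isT).
  by case: (x) => [|[|[|[|[|y]]]]].
have [//|P1 [P2 [EP dec cP1]]] := searchP (searchd x x14) sx _ k_gt0 oks.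
apply: (IHm P1 ((P2 ++ [:: x]) :: Es)).
- by apply: leq_trans Pm; rewrite EP size_cat leq_addr.
- by rewrite SE EP /= cat_rcons -!catA.
- rewrite /chain /=; case/andP: chainE => -> srt; apply/andP; split; first by case: (P2).
  case: (Es) cutE srt => // E Es' []; rewrite ?last_rcons //; first by case: (P).
  by move=> /= cE _ ->; rewrite last_cat /= cE.
- by rewrite /= dec.
move=> P10 _; split; first exact: cP1.
rewrite /=; case: (altP (Es =P [::])) => [->|Es0]; first by rewrite cats0 cP1.
have [|_ cEs] := cutE _ Es0; first by case: (P).
rewrite last_rcons in cEs; apply: cut_cat; rewrite ?last_cat //= ?cP1 //.
have R0 : flatten Es != [::] by case/cut_head/andP: cEs.
move: dayPR; rewrite -(prednK k_gt0) => /day_strict/(strict_catl R0).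
by rewrite all_rcons => /andP[/andP[_ x3] _]; rewrite ltn_eqF.
Qed.
End Search.

(** * The cosmological theorem *)

(** Ten days of ancestors, a look-ahead of five letters and eighteen days of decay;
    100 bounds the length of the pieces. *)
Lemma search_succeeds : search_all 10 5 18 100.
Proof. by vm_cast_no_check (erefl true). Qed.

Lemma base_decays w : base w -> splits_into in_table (iter 28 JHC w).
Proof.
move=> bw; have day10 : day 10 (iter 10 JHC w) by exists w.
have [//|//|Es [SE chainE decE]] := search_allP _ _ search_succeeds day10.
rewrite (iterD 18 10); apply: (@splits_into_flatten _ _ _ Es).
  by move=> n; rewrite SE; apply: (chain_iter chainE) => x E _; apply: cut_apart.
by move=> E /(allP decE)/decaysP.
Qed.

(** Nine values of [n] are needed: in 13221133.122211332 the letter 3 first comes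
    to the front of the right part on day 8. *)
Definition indivisible E := all (fun i =>
  has (fun n => last 0 (take i E) == head 0 (iter n JHC (drop i E))) (iota 0 9))
  (iota 1 (size E).-1).

Lemma table_indivisible E : E \in table4 -> [&& is_string E, tame E & indivisible E].
Proof. by apply/allP: E; vm_cast_no_check (erefl true). Qed.

(** A splitting of the renamed element would, by [splits_apart], keep the last
    letter of [L] away from the front of [R] forever; renaming reduces the
    contradiction to the word ending with 4. *)
Lemma table_atom n E : 4 <= n -> E \in table4 -> atom (map (swap4 n) E).
Proof.
move=> n4 /table_indivisible/and3P[/andP[E0 zE] tE indE].
have swap0 x : (swap4 n x == 0) = (x == 0).
  rewrite -{1}(swap4_small n4 (leq0n 3)); exact: inj_eq (inv_inj (swap4K n)) _ _.
split.
  rewrite /is_string -size_eq0 size_map size_eq0 E0; apply: contra zE.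
  by case/mapP=> x Ex /esym/eqP; rewrite swap0 => /eqP<-.
move=> L R L0 R0 ELR splitsLR; pose i := size L.
have EL : L = map (swap4 n) (take i E) by rewrite map_take ELR take_size_cat.
have ER : R = map (swap4 n) (drop i E) by rewrite map_drop ELR drop_size_cat.
have sizeE : size E = i + size R by rewrite -(size_map (swap4 n)) ELR size_cat.
have L'0 : take i E != [::] by move: L0; rewrite EL -!size_eq0 size_map.
have /hasP[m _ /eqP Em] :
  has (fun m => last 0 (take i E) == head 0 (iter m JHC (drop i E))) (iota 0 9).
  apply: (allP indE); rewrite mem_iota lt0n size_eq0 L0 /= sizeE.
  by rewrite -subn1 subnKC ?addn_gt0 ?lt0n ?size_eq0 ?L0 // -addn1 leq_add2l lt0n size_eq0.
have := splits_apart m L0 R0 splitsLR; rewrite EL ER iter_JHC_map.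
- case: (take i E) L'0 Em => //= a w _ Em.
  have : iter m JHC (drop i E) != [::].
    by rewrite iter_JHC_nil; move: R0; rewrite ER -!size_eq0 size_map.
  by case: (iter m JHC (drop i E)) Em => //= b v <- _; rewrite last_map eqxx.
- exact: inv_inj (swap4K n).
- by move=> x _; apply: swap4_small.
- apply: tame_infix tE; rewrite -{2}(cat_take_drop i E).
  by apply: suffix_infix; apply: suffix_suffix.
Qed.

Lemma table_common_transuranic n E : 4 <= n -> E \in table4 ->
  common (map (swap4 n) E) \/ transuranic (map (swap4 n) E).
Proof.
move=> n4; have fixed w : all (leq^~ 3) w -> map (swap4 n) w = w.
  by move=> w3; apply: map_id_in => x /(allP w3)/swap4_small->.
have swap4n : swap4 n 4 = n by rewrite /swap4 eqxx.
rewrite inE => /predU1P[->|].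
  by right; exists n => //; left; rewrite map_rcons swap4n fixed.
rewrite inE => /predU1P[->|tE].
  by right; exists n => //; right; rewrite map_rcons swap4n fixed.
left; rewrite fixed //; apply: (allP _ _ tE).
by vm_compute.
Qed.

Lemma all_pos_JHC w : all (leq 1) w -> all (leq 1) (JHC w).
Proof.
rewrite -{1}(runsK w) JHC_spell; have /andP[] := wf_runs_runs w.
elim: (runs w) => // -[[|m] a] rs IHrs // rs0 srs.
rewrite -[unruns (_ :: _)]/(nseq m.+1 a ++ unruns rs) all_cat => /andP[/andP[a0 _] lrs].
by rewrite -[spell (_ :: _)]/[:: m.+1, a & spell rs] /= a0 IHrs //; exact: path_sorted srs.
Qed.

Theorem mainTheorem2 (w : seq nat) (hw : is_string w) :
  exists2 k, k <= 29 &
    compound_of (fun E => common E \/ transuranic E) (iter k JHC w).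
Proof.
exists 29 => //; have /andP[w0 zw] := hw.
set P := fun E => common E \/ transuranic E.
suff [Es EsP sE] : splits_into (fun E => atom E /\ P E) (iter 29 JHC w).
  exists Es => [|E /EsP[]//]; split=> [|E /EsP[]//|//].
  apply: contra w0 => /eqP Es0; rewrite -(iter_JHC_nil 29).
  by rewrite -[iter 29 _ _]/(iter 0 JHC (iter 29 JHC w)) sE Es0.
rewrite iterSr; have tw := tame_JHC w.
have pw : all (leq 1) (JHC w).
  by apply/all_pos_JHC/allP => -[|x] // wx; rewrite wx in zw.
apply: (@splits_into_flatten _ _ _ (pieces big_cut (JHC w))) => [|C wC].
  apply: pieces_iter => x C wC; apply: big_cut_apart.
    by case/andP: (chain_pieces big_cut (JHC w)) => /allP/(_ C wC).
  exact: tame_infix (pieces_infix wC) tw.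
have [||n n4 bC] := rename_chunk _ _ (pieces_big_cut_sorted wC).
- by apply/allP => x Cx; apply: (allP pw); apply: mem_infix (pieces_infix wC) _ Cx.
- exact: tame_infix (pieces_infix wC) tw.
have [Es EsT sE] := base_decays bC.
have /and3P[_ _ tC] := bC.
have swap_inj := inv_inj (swap4K n).
have swap_fix m (_ : 0 < m) := @swap4_small n m n4.
exists (map (map (swap4 n)) Es) => [F /mapP[E /EsT tE ->]|m].
  by split; [apply: table_atom | apply: table_common_transuranic].
rewrite -[C](mapK (swap4K n)) -iterD iter_JHC_map // iterD sE map_flatten -!map_comp.
congr flatten; apply/eq_in_map => E /EsT tE /=; rewrite iter_JHC_map //.
by case/table_indivisible/and3P: tE.
Qed.
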